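(* Let $1\le p<\infty$ and let $\{A_n\}_n$ and $\{B_n\}_n$ be two sequences of matrices of increasing size, $A_n,B_n\in M_n(\mathbb C)$. Then $\{A_n-B_n\}_n$ converges to $\{O_n\}_n$ in Type 2 weak cluster sense if and only if $q_{w^p}(\{A_n-B_n\}_n)=0$.
   Context: $\|\cdot\|$ is the spectral norm, $\|\cdot\|_{sp}$ the Schatten $p$-norm, and $O_n$ the $n\times n$ zero matrix. For a sequence $\{A_n\}_n$ with $A_n\in M_n(\mathbb C)$ and $1\le p<\infty$, $$q_{w^p}(\{A_n\}_n)=\inf\Big\{\limsup_{n\to\infty}\frac{\|N_n\|_{sp}}{n^{1/p}} : R_n+N_n=A_n,\ \lim_{n\to\infty}\tfrac{\operatorname{rank}R_n}{n}=0\Big\},$$ the infimum being over all decompositions $\{A_n\}_n=\{R_n\}_n+\{N_n\}_n$ with $R_n,N_n\in M_n(\mathbb C)$. $\{A_n-B_n\}_n$ converges to $\{O_n\}_n$ in Type 2 weak cluster sense if for every $\epsilon>0$ there exist integers $n_{1,\epsilon}$ and $n_{2,\epsilon}$, where $n_{1,\epsilon}=n_{1,\epsilon}(n)$ may depend on both $n$ and $\epsilon$ and is $o(n)$ as $n\to\infty$, such that for all $n>n_{2,\epsilon}$ one has $A_n-B_n=R_n+N_n$ with $\operatorname{rank}R_n\le n_{1,\epsilon}$ and $\|N_n\|<\epsilon$. *)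

(* Defs.v *)
From HB Require Import structures.
From mathcomp Require Import all_boot all_order all_algebra.
From mathcomp Require Import complex.
From mathcomp Require Import all_classical all_reals all_analysis.

Set Implicit Arguments.
Unset Strict Implicit.
Unset Printing Implicit Defensive.

Import Order.TTheory GRing.Theory Num.Theory.
Import numFieldNormedType.Exports.

Local Open Scope classical_set_scope.
Local Open Scope ring_scope.
Local Open Scope complex_scope.
Local Open Scope sesquilinear_scope.

(* [A ^t* *m A] is Hermitian positive semidefinite, so [spectral_diag] lists
   its eigenvalues, counted with multiplicity, and they are nonnegative reals;
   the singular values come in no particular order. *)
Definition singular_value (R : realType) (n : nat) (A : 'M[R[i]]_n)
    (i : 'I_n) : R :=
  Num.sqrt (complex.Re (spectral_diag (A ^t* *m A) 0 i)).

Definition spectral_norm (R : realType) (n : nat) (A : 'M[R[i]]_n) : R :=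
  \big[Num.max/0]_(i < n) singular_value A i.

Definition schatten_norm (R : realType) (p : R) (n : nat)
    (A : 'M[R[i]]_n) : R :=
  (\sum_(i < n) singular_value A i `^ p) `^ p^-1.

Definition mxsequence (R : realType) := forall n : nat, 'M[R[i]]_n.

(* Valued in [\bar R]: the limsup of a decomposition may be +oo. *)
Definition q_wp (R : realType) (p : R) (A : mxsequence R) : \bar R :=
  ereal_inf [set x : \bar R | exists Rn Nn : mxsequence R,
    [/\ forall n, Rn n + Nn n = A n,
        (\rank (Rn n))%:R / n%:R @[n --> \oo] --> (0 : R) &
        x = limn_esup (fun n =>
          (schatten_norm p (Nn n) / n%:R `^ p^-1)%:E)]].

Definition type2_weak_cluster_zero (R : realType) (D : mxsequence R) : Prop :=
  forall eps : R, 0 < eps ->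
  exists (n1 : nat -> nat) (n2 : nat),
    (fun n => (n1 n)%:R : R) =o_\oo (fun n => n%:R : R) /\
    forall n, (n2 < n)%N -> exists Rn Nn : 'M[R[i]]_n,
      [/\ D n = Rn + Nn,
          (\rank Rn <= n1 n)%N &
          spectral_norm Nn < eps].

(* Main.v *)
Require Import Defs.
From mathcomp Require Import all_boot all_order all_algebra.
From mathcomp Require Import complex.
From mathcomp Require Import all_classical all_reals all_analysis.

(** Both conditions say that, up to a perturbation of rank [o(n)], the matrix
    [D n = A n - B n] is small: in operator norm for the weak cluster, in
    normalized Schatten norm for [q_wp].

    A weak cluster makes [q_wp] small because each singular value is at most
    the spectral norm, whence [schatten_norm p N <= e * n `^ p^-1] as soon as
    [spectral_norm N <= e] ([schatten_norm_le]).

    Conversely, a matrix [N] of small normalized Schatten norm has few singular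
    values above a fixed level [e], by the Markov inequality
    ([card_singular_value_ge_mean]).  Removing the corresponding singular
    directions is a perturbation whose rank is the number of these singular
    values, and what remains has spectral norm below [e] ([truncation]).
    Only arbitrarily small proportions, not [o(n)], come out of a single
    decomposition of [D], since [q_wp] is an infimum that need not be attained.
    The bound [n1] is therefore defined without reference to a decomposition,
    as the least rank at which [D n] can be brought below [e]: every
    decomposition bounds it from above, which makes it [o(n)] with no
    diagonal argument. *)

Import Order.TTheory GRing.Theory Num.Theory.
Import numFieldNormedType.Exports.

Local Open Scope classical_set_scope.
Local Open Scope ring_scope.
Local Open Scope complex_scope.
Local Open Scope sesquilinear_scope.

(** * Spectra of Gram matrices *)

Lemma rank_diag_mx_le {F : fieldType} {n : nat} (d : 'rV[F]_n) :
  (\rank (diag_mx d) <= #|[pred i | d 0%R i != 0%R]|)%N.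
Proof.
rewrite diag_mx_sum_delta -sum1_card [leqRHS]big_mkcond /=.
apply: (big_ind2 (fun (A : 'M[F]_n) (a : nat) => \rank A <= a)%N)
  => [|A a B b Aa Bb|i _]; first by rewrite mxrank0.
  exact: leq_trans (mxrank_add A B) (leq_add Aa Bb).
rewrite inE; case: eqP => [->|_] /=; first by rewrite scale0r mxrank0.
by rewrite (leq_trans (mxrank_scale _ _))// mxrank_delta.
Qed.

Lemma gram_normalmx {C : numClosedFieldType} {m n : nat} (A : 'M[C]_(m, n)) :
  A ^t* *m A \is normalmx.
Proof. by apply/normalmxP; rewrite trmx_mul map_mxM trmxCK. Qed.

(** [spectral_diag] comes from a chosen diagonalization; this lemma relates it
    to any other one.  The matrix [W] of change of eigenbasis intertwines the
    two diagonals, so a nonzero entry [W i j] forces the [i]-th and [j]-th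
    diagonal entries to agree. *)
Lemma spectral_diag_diagonalized {C : numClosedFieldType} {n : nat}
    {M P : 'M[C]_n} {d : 'rV[C]_n} (i : 'I_n) :
  M \is normalmx -> P \in unitmx -> M = invmx P *m diag_mx d *m P ->
  exists j, spectral_diag M 0 i = d 0 j.
Proof.
move=> /orthomx_spectralP; set S := spectralmx M; set s := spectral_diag M.
move=> MS Pu MP; have Su : S \in unitmx by exact: spectral_unit.
pose W := S *m invmx P.
have WE : diag_mx s *m W = W *m diag_mx d.
  have sS : diag_mx s *m S = S *m M by rewrite [in RHS]MS !mulmxA mulmxV// mul1mx.
  by rewrite /W mulmxA sS MP !mulmxA mulmxK.
(* [W] is invertible, so its [i]-th row cannot vanish *)
have : row i W != 0.
  rewrite rowE mulmxA; apply/eqP => /(congr1 (mulmxr P)) /=.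
  rewrite mulmxKV// mul0mx => /(congr1 (mulmxr (invmx S))) /=.
  rewrite mulmxK// mul0mx => /rowP/(_ i); rewrite !mxE !eqxx /= => /eqP.
  by rewrite oner_eq0.
move=> /rV0Pn[j]; rewrite mxE => Wij; exists j.
move/matrixP: WE => /(_ i j); rewrite mul_diag_mx mul_mx_diag mxE [RHS]mxE => WE.
by apply: (mulIf Wij); rewrite [RHS]mulrC.
Qed.

(** * Singular values and the two norms *)

Lemma singular_value_ge0 {R : realType} {n : nat} (A : 'M[R[i]]_n) (i : 'I_n) :
  0 <= singular_value A i.
Proof. exact: sqrtr_ge0. Qed.

Lemma singular_value_le_spectral_norm {R : realType} {n : nat} (A : 'M[R[i]]_n)
    (i : 'I_n) :
  singular_value A i <= spectral_norm A.
Proof. exact: le_bigmax. Qed.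

(** The spectral projections [Q b] and [Q g] of [A ^t* *m A] onto the large and
    the small singular values split [A] as [A *m Q b + A *m Q g].  The Gram
    matrix of [A *m Q g] is diagonal in the same basis, with the large
    eigenvalues replaced by zero, hence the bound on its spectral norm. *)
Lemma truncation {R : realType} {n : nat} (A : 'M[R[i]]_n) {e : R} :
  0 < e -> exists K N : 'M[R[i]]_n,
    [/\ A = K + N, (\rank K <= #|[pred i | (e <= singular_value A i)%R]|)%N &
        spectral_norm N < e].
Proof.
move=> e0; pose P := spectralmx (A ^t* *m A).
pose d := spectral_diag (A ^t* *m A).
have Pu : P \in unitmx by exact: spectral_unit.
have PE : invmx P = P ^t* by rewrite invmx_unitary// spectral_unitarymx.
have gramE : A ^t* *m A = invmx P *m diag_mx d *m P.
  exact/orthomx_spectralP/gram_normalmx.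
pose large (i : 'I_n) := e <= singular_value A i.
pose b : 'rV[R[i]]_n := \row_i (large i)%:R.
pose g : 'rV[R[i]]_n := \row_i (~~ large i)%:R.
have bg : diag_mx b + diag_mx g = 1%:M.
  rewrite -raddfD /= -diag_const_mx; congr diag_mx.
  by apply/rowP => i; rewrite !mxE; case: (large i); rewrite (addr0, add0r).
pose Q (x : 'rV_n) := invmx P *m diag_mx x *m P.
exists (A *m Q b), (A *m Q g); split.
- by rewrite -mulmxDr /Q -mulmxDl -mulmxDr bg mulmx1 mulVmx// mulmx1.
- apply: leq_trans (mxrankM_maxr _ _) _.
  apply: leq_trans (mxrankM_maxl _ _) _.
  apply: leq_trans (mxrankM_maxr _ _) _.
  apply: leq_trans (rank_diag_mx_le _) _.
  apply: subset_leq_card; apply/fintype.subsetP => i; rewrite !inE mxE.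
  by rewrite -/(large i); case: (large i) => /=; rewrite ?eqxx.
- have QgT : (Q g) ^t* = Q g.
    rewrite /Q PE !trmx_mul !map_mxM trmxCK mulmxA; congr (_ *m _ *m _).
    rewrite tr_diag_mx map_diag_mx; congr diag_mx.
    by apply/rowP => i; rewrite !mxE rmorph_nat.
  have NE : (A *m Q g) ^t* *m (A *m Q g)
      = invmx P *m diag_mx (\row_i (d 0 i * (~~ large i)%:R)) *m P.
    rewrite trmx_mul map_mxM QgT mulmxA -[_ *m _ *m A]mulmxA gramE /Q.
    rewrite !mulmxA !mulmxK//.
    rewrite -(mulmxA _ (diag_mx g) (diag_mx d)) mulmx_diag.
    rewrite -(mulmxA _ (diag_mx _) (diag_mx g)) mulmx_diag.
    congr (_ *m diag_mx _ *m _); apply/rowP => i; rewrite !mxE.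
    by case: (large i) => /=; rewrite ?(mulr0, mul0r, mulr1, mul1r).
  apply: bigmax_lt => // i _; rewrite /singular_value.
  have [j ->] := spectral_diag_diagonalized i (gram_normalmx _) Pu NE.
  rewrite mxE; case: (boolP (large j)) => [_|] /=.
    by rewrite mulr0 sqrtr0.
  by rewrite mulr1 -ltNge.
Qed.

Lemma schatten_norm_le {R : realType} {p : R} {n : nat} {A : 'M[R[i]]_n}
    {e : R} :
  0 < p -> 0 <= e -> spectral_norm A <= e ->
  schatten_norm p A <= e * n%:R `^ p^-1.
Proof.
move=> p0 e0 Ae.
have pp : e = (e `^ p) `^ p^-1 by rewrite -powRrM mulfV ?gt_eqF// powRr1.
rewrite [X in X * _]pp -powRM ?powR_ge0// /schatten_norm.
apply: ge0_ler_powR; rewrite ?nnegrE ?invr_ge0 ?(ltW p0)//.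
- by apply: sumr_ge0 => i _; exact: powR_ge0.
- by rewrite mulr_ge0 ?powR_ge0.
- have -> : e `^ p * n%:R = \sum_(i < n) e `^ p.
    by rewrite sumr_const card_ord mulr_natr.
  apply: ler_sum => i _; apply: ge0_ler_powR; rewrite ?nnegrE ?(ltW p0)//.
    exact: singular_value_ge0.
  exact: le_trans (singular_value_le_spectral_norm A i) Ae.
Qed.

(** The Markov inequality for the counting measure on the singular values. *)
Lemma card_singular_value_ge {R : realType} {p : R} {n : nat}
    (A : 'M[R[i]]_n) {e : R} :
  0 < p -> 0 <= e ->
  #|[pred i | e <= singular_value A i]|%:R * e `^ p <= schatten_norm p A `^ p.
Proof.
move=> p0 e0; rewrite /schatten_norm -powRrM mulVf ?gt_eqF// powRr1; last first.
  by apply: sumr_ge0 => i _; exact: powR_ge0.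
rewrite mulr_natl -sumr_const big_mkcond /=; apply: ler_sum => i _.
rewrite inE; case: ifP => [ei|_]; last exact: powR_ge0.
by apply: ge0_ler_powR; rewrite ?nnegrE ?(ltW p0)// singular_value_ge0.
Qed.

(** The Markov inequality gives the proportion [c `^ p]; as [c <= 1 <= p], it is
    at most [c], which spares the exponent in later uses. *)
Lemma card_singular_value_ge_mean {R : realType} {p : R} {n : nat}
    {A : 'M[R[i]]_n} {e c : R} :
  1 <= p -> 0 < e -> 0 < c <= 1 -> (0 < n)%N ->
  schatten_norm p A / n%:R `^ p^-1 <= c * e ->
  #|[pred i | e <= singular_value A i]|%:R <= c * n%:R.
Proof.
move=> p1 e0 /andP[c0 c1] n0.
have p0 : 0 < p by exact: lt_le_trans p1.
have np : 0 < n%:R `^ p^-1 :> R by rewrite powR_gt0// ltr0n.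
rewrite ler_pdivrMr// => Ac.
rewrite -(ler_pM2r (powR_gt0 p e0)).
apply: le_trans (card_singular_value_ge A p0 (ltW e0)) _.
have : schatten_norm p A `^ p <= (c * e * n%:R `^ p^-1) `^ p.
  apply: ge0_ler_powR; rewrite ?nnegrE ?(ltW p0) ?powR_ge0//.
  by rewrite !mulr_ge0 ?(ltW c0) ?(ltW e0) ?(ltW np).
move/le_trans; apply.
rewrite powRM ?(ltW np) ?mulr_ge0 ?(ltW c0) ?(ltW e0)//.
rewrite powRM ?(ltW c0) ?(ltW e0)// -powRrM mulVf ?gt_eqF// powRr1//.
rewrite mulrAC ler_wpM2r ?powR_ge0// ler_wpM2r//.
by apply: ge1r_powR => //; rewrite c0.
Qed.

(** * Limits superior *)

Lemma limn_esup_lt_near {R : realType} {u : (\bar R)^nat} {x : \bar R} :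
  (limn_esup u < x)%E -> \forall n \near \oo, (u n < x)%E.
Proof.
rewrite /limn_esup limf_esupE => /ereal_inf_lt[_ [V Voo <-]] Vx.
apply: filterS Voo => n Vn; apply: le_lt_trans Vx.
by apply: ereal_sup_ubound; exists n.
Qed.

Lemma limn_esup_le_near {R : realType} {u : (\bar R)^nat} {x : \bar R} :
  (\forall n \near \oo, (u n <= x)%E) -> (limn_esup u <= x)%E.
Proof.
move=> ux; rewrite /limn_esup limf_esupE; apply: ge_ereal_inf.
exists (ereal_sup [set u n | n in [set n | (u n <= x)%E]]); last first.
  by apply: ge_ereal_sup => _ [n un <-].
by exists [set n | (u n <= x)%E].
Qed.

(** * Weak clusters and [q_wp] *)

Lemma q_wp_ge0 {R : realType} (p : R) (D : mxsequence R) : (0 <= q_wp p D)%E.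
Proof.
apply: le_ereal_inf_tmp => _ [K [N [_ _ ->]]]; apply: limf_esup_ge0.
  by case=> m _ /(_ m) /=; apply.
by move=> n; rewrite lee_fin divr_ge0// powR_ge0.
Qed.

Lemma type2_weak_cluster_zero_q_wp_le {R : realType} {p : R}
    {D : mxsequence R} {e : R} :
  0 < p -> type2_weak_cluster_zero D -> 0 < e -> (q_wp p D <= e%:E)%E.
Proof.
move=> p0 wc e0; have [r [m [/eqoP ro dec]]] := wc e e0.
(* the weak cluster only splits [D n] for [m < n]; below, any splitting does *)
have KN_ex n : exists KN : 'M[R[i]]_n * 'M[R[i]]_n,
    D n = KN.1 + KN.2 /\
    ((m < n)%N -> (\rank KN.1 <= r n)%N /\ spectral_norm KN.2 < e).
  have [mn|nm] := ltnP m n; last by exists (D n, 0); rewrite addr0.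
  by have [K [N [DE rK Ne]]] := dec n mn; exists (K, N).
pose KN n := sval (cid (KN_ex n)).
have KNP n := svalP (cid (KN_ex n)).
apply: ge_ereal_inf; eexists.
  exists (fun n => (KN n).1), (fun n => (KN n).2); split; [|..|reflexivity].
  - by move=> n; have [] := KNP n.
  - apply/cvgr0Pnorm_lt => c c0; near=> n.
    have mn : (m < n)%N by near: n; exists m.+1.
    have n0 : 0 < n%:R :> R by rewrite ltr0n (leq_trans _ mn).
    have [_ /(_ mn)[rK _]] := KNP n.
    rewrite ger0_norm ?divr_ge0// ltr_pdivrMr//.
    have : `|(r n)%:R| <= c / 2 * `|n%:R| :> R.
      by near: n; apply: ro; rewrite divr_gt0.
    rewrite !ger0_norm// => rn.
    apply: (@le_lt_trans _ _ (c / 2 * n%:R)).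
      by apply: le_trans rn; rewrite ler_nat.
    by rewrite ltr_pM2r// gtr_pMr// invf_lt1// ltr1n.
apply: limn_esup_le_near; near=> n.
have mn : (m < n)%N by near: n; exists m.+1.
have n0 : 0 < n%:R :> R by rewrite ltr0n (leq_trans _ mn).
have [_ /(_ mn)[_ Ne]] := KNP n.
rewrite lee_fin ler_pdivrMr ?powR_gt0//.
by apply: schatten_norm_le => //; exact: ltW.
Unshelve. all: by end_near. Qed.

Lemma q_wp_eq0_type2_weak_cluster_zero {R : realType} {p : R}
    {D : mxsequence R} :
  1 <= p -> q_wp p D = 0%E -> type2_weak_cluster_zero D.
Proof.
move=> p1 q0 e e0.
pose splits n r := `[< exists K N : 'M[R[i]]_n,
  [/\ D n = K + N, (\rank K <= r)%N & spectral_norm N < e] >].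
have splits_ex n : exists r, splits n r.
  have [K [N [DE _ Ne]]] := truncation (D n) e0.
  by exists (\rank K); apply/asboolP; exists K, N.
pose rmin n := ex_minn (splits_ex n).
exists rmin, 0%N; split; last first.
  by move=> n _; rewrite /rmin; case: ex_minnP => r /asboolP.
(* [h] is the share of [n] allowed to each of the two low-rank parts: that of a
   near-optimal decomposition of [D], and that truncated from its small part *)
apply/eqoP => c c0; pose h := Num.min (c / 2) 1.
have h0 : 0 < h by rewrite lt_min ltr01 divr_gt0.
have h1 : h <= 1 by rewrite ge_min lexx orbT.
have hc : h + h <= c.
  by rewrite [leRHS](splitr c) lerD// ge_min lexx.
have : (q_wp p D < (h * e)%:E)%E by rewrite q0 lte_fin mulr_gt0.
case/ereal_inf_lt => _ [K [N [DE Ksmall ->]]] /limn_esup_lt_near Nsmall.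
move/cvgr0Pnorm_lt : Ksmall => /(_ _ h0) Ksmall.
near=> n.
have n0 : (0 < n)%N by near: n; exists 1%N.
have n0R : 0 < n%:R :> R by rewrite ltr0n.
rewrite !ger0_norm//.
have [K' [N' [NE rK' N'e]]] := truncation (N n) e0.
have rK'h : (\rank K')%:R <= h * n%:R.
  have Nh : schatten_norm p (N n) / n%:R `^ p^-1 <= h * e.
    by rewrite -lee_fin; apply: ltW; near: n.
  apply: le_trans (card_singular_value_ge_mean p1 e0 _ n0 Nh).
    by rewrite ler_nat.
  by rewrite h0.
have rKh : (\rank (K n))%:R <= h * n%:R.
  have : `|(\rank (K n))%:R / n%:R| < h by near: n.
  by rewrite ger0_norm ?divr_ge0// ltr_pdivrMr// => /ltW.
have : (rmin n <= \rank (K n) + \rank K')%N.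
  rewrite /rmin; case: ex_minnP => r _; apply; apply/asboolP.
  by exists (K n + K'), N'; rewrite -DE NE addrA mxrank_add.
rewrite -(ler_nat R) natrD => /le_trans; apply.
apply: le_trans (lerD rKh rK'h) _.
by rewrite -mulrDl ler_wpM2r.
Unshelve. all: by end_near. Qed.

Theorem corollary2p10 (R : realType) (p : R) (hp : 1 <= p)
    (A B : mxsequence R) :
  type2_weak_cluster_zero (fun n => A n - B n) <->
  q_wp p (fun n => A n - B n) = 0%E.
Proof.
split=> [wc|]; last exact: q_wp_eq0_type2_weak_cluster_zero.
apply/eqP; rewrite eq_le q_wp_ge0 andbT.
apply/lee_addgt0Pr => e e0; rewrite add0e.
by apply: type2_weak_cluster_zero_q_wp_le => //; exact: lt_le_trans hp.
Qed.
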